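(* Let $\chi:\mathcal I_X\times\mathcal I_W\to\{0,1\}$ be the residual-threshold predicate, with $\mathcal I_X=\{0,\dots,N_X-1\}$ and $\mathcal I_W=\{0,\dots,N_W-1\}$, and let $|\Psi_X\rangle=\sum_{i=0}^{N_X-1}\alpha_i|i\rangle_X$ with $\sum_{i=0}^{N_X-1}|\alpha_i|^2=1$. For $j\in\mathcal I_W$ let $$S_\chi^{(j)}=\sum_{i=0}^{N_X-1}(-1)^{\chi(i,j)}|i\rangle\langle i|_X,\qquad q(w_j)=\sum_{i=0}^{N_X-1}|\alpha_i|^2\chi(i,j).$$ Then for every $j\in\mathcal I_W$, $$\langle\Psi_X|S_\chi^{(j)}|\Psi_X\rangle=1-2q(w_j).$$
   Context: $\{|i\rangle_X\}_{i=0}^{N_X-1}$ is the orthonormal computational basis of the spatial register $\mathcal H_X=(\mathbb C^2)^{\otimes n_X}$, $N_X=2^{n_X}$; $|i\rangle_X$ encodes a collocation point $x_i$, and $j\in\mathcal I_W$ indexes parameter vectors $w_j$, $N_W=2^{n_W}$. For a residual map $r$ assigning a real (fixed-point) value $r(x_i,w_j)$ to each pair and a tolerance $\varepsilon_{\mathrm{tol}}>0$, the residual-threshold predicate is $\chi(i,j)=1$ if $|r(x_i,w_j)|<\varepsilon_{\mathrm{tol}}$ and $\chi(i,j)=0$ otherwise. The quantity $q(w_j)$ is called the effective oracle score: the spatially weighted fraction of collocation points at which $w_j$ satisfies the residual threshold. *)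

(* Defs.v *)
From HB Require Import structures.
From mathcomp Require Import all_boot all_order all_algebra.
From mathcomp Require Import reals.
From mathcomp Require Import complex.

Set Implicit Arguments.
Unset Strict Implicit.
Unset Printing Implicit Defensive.

Import Order.TTheory GRing.Theory Num.Theory.
Local Open Scope ring_scope.

(* The n-qubit space (C^2)^{(x) n} is taken in coordinates with respect to its
   computational basis, i.e. as column vectors of length 2 ^ n over R[i]. *)
Notation qstate R n := 'cV[R[i]]_(2 ^ n).
Notation qop R n := 'M[R[i]]_(2 ^ n).

Definition ket (R : realType) (n : nat) (i : 'I_(2 ^ n)) : qstate R n :=
  delta_mx i 0.
Arguments ket R {n} i.

Definition adjoint (R : realType) (m n : nat) (A : 'M[R[i]]_(m, n)) :
    'M[R[i]]_(n, m) :=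
  map_mx Num.conj A^T.

(* <u|A|u> *)
Definition braket (R : realType) (n : nat) (u : qstate R n) (A : qop R n) :
    R[i] :=
  (adjoint u *m A *m u) 0 0.

Definition residual_predicate (R : realType) (X W : Type) (r : X -> W -> R)
    (eps : R) (nX nW : nat) (x : 'I_(2 ^ nX) -> X) (w : 'I_(2 ^ nW) -> W)
    (i : 'I_(2 ^ nX)) (j : 'I_(2 ^ nW)) : bool :=
  `|r (x i) (w j)| < eps.

Definition spatial_state (R : realType) (nX : nat)
    (alpha : 'I_(2 ^ nX) -> R[i]) : qstate R nX :=
  \sum_(i < 2 ^ nX) alpha i *: ket R i.

Definition phase_oracle (R : realType) (nX nW : nat)
    (chi : 'I_(2 ^ nX) -> 'I_(2 ^ nW) -> bool) (j : 'I_(2 ^ nW)) : qop R nX :=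
  \sum_(i < 2 ^ nX)
     (-1) ^+ (chi i j : nat) *: (ket R i *m adjoint (ket R i)).
Arguments phase_oracle R {nX nW} chi j.

(* ComplexField.Normc.normc is the R-valued modulus on R[i]; the generic norm
   of R[i] takes its values in R[i]. *)
Definition effective_score (R : realType) (nX nW : nat)
    (alpha : 'I_(2 ^ nX) -> R[i]) (chi : 'I_(2 ^ nX) -> 'I_(2 ^ nW) -> bool)
    (j : 'I_(2 ^ nW)) : R :=
  \sum_(i < 2 ^ nX) ComplexField.Normc.normc (alpha i) ^+ 2 * (chi i j : nat)%:R.

(* Main.v *)
Require Import Defs.
From HB Require Import structures.
From mathcomp Require Import all_boot all_order all_algebra.
From mathcomp Require Import reals.
From mathcomp Require Import complex.

Import Order.TTheory GRing.Theory Num.Theory.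
Local Open Scope ring_scope.
Local Open Scope complex_scope.

Lemma norm_normc (R : rcfType) (z : R[i]) :
  `|z| = (ComplexField.Normc.normc z)%:C.
Proof. by case: z => a b; rewrite normc_def. Qed.

Lemma spatial_stateE (R : realType) (nX : nat) (alpha : 'I_(2 ^ nX) -> R[i]) :
  spatial_state alpha = \col_i alpha i.
Proof.
apply/colP => k; rewrite summxE (bigD1 k) //= big1 ?addr0 => [|i /negbTE ik].
  by rewrite !mxE !eqxx mulr1.
by rewrite !mxE eq_sym ik mulr0.
Qed.

Lemma ket_adjoint_ket (R : realType) (n : nat) (i : 'I_(2 ^ n)) :
  ket R i *m adjoint (ket R i) = delta_mx i i.
Proof.
rewrite /adjoint /ket trmx_delta.
have -> : map_mx Num.conj (delta_mx 0 i) = delta_mx 0 i :> 'rV[R[i]]_(2 ^ n).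
  by apply/matrixP => a b; rewrite !mxE conjC_nat.
by rewrite mul_delta_mx.
Qed.

Lemma phase_oracleE (R : realType) (nX nW : nat)
    (chi : 'I_(2 ^ nX) -> 'I_(2 ^ nW) -> bool) (j : 'I_(2 ^ nW)) :
  phase_oracle R chi j = diag_mx (\row_i (-1) ^+ (chi i j : nat)).
Proof.
rewrite diag_mx_sum_delta; apply: eq_bigr => i _.
by rewrite ket_adjoint_ket mxE.
Qed.

(** A diagonal operator does not mix basis states, so no cross terms $\bar u_i u_k$ with $i \neq k$
    survive. *)
Lemma braket_diag (R : realType) (n : nat) (u : qstate R n)
    (d : 'rV[R[i]]_(2 ^ n)) :
  braket u (diag_mx d) = \sum_i d 0 i * `|u i 0| ^+ 2.
Proof.
rewrite /braket mxE; apply: eq_bigr => i _.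
by rewrite mul_mx_diag !mxE mulrAC mulrC normCKC.
Qed.

Theorem lemma4p3 (R : realType) (X W : Type) (r : X -> W -> R) (eps : R)
    (heps : 0 < eps) (nX nW : nat)
    (x : 'I_(2 ^ nX) -> X) (w : 'I_(2 ^ nW) -> W)
    (alpha : 'I_(2 ^ nX) -> R[i])
    (halpha : \sum_(i < 2 ^ nX) ComplexField.Normc.normc (alpha i) ^+ 2 = 1) :
  let chi := residual_predicate r eps x w in
  forall j : 'I_(2 ^ nW),
    braket (spatial_state alpha) (phase_oracle R chi j)
    = (1 - 2 * effective_score alpha chi j)%:C.
Proof.
move=> chi j; rewrite phase_oracleE spatial_stateE braket_diag.
(* Writing 1 as the total weight turns the goal into an equality of sums, provable term by term. *)
rewrite -[X in X - _]halpha /effective_score mulr_sumr -sumrB rmorph_sum /=.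
apply: eq_bigr => i _; rewrite !mxE norm_normc -rmorphXn /=.
case: (chi i j); rewrite ?expr1 ?expr0 ?mulr1 ?mulr0 ?subr0 ?mul1r //.
(* Only $\chi = 1$ remains: $-a = a - 2a$ with $a = |\alpha_i|^2$. *)
by rewrite mulN1r -rmorphN /= mulr_natl mulr2n opprD addrA subrr sub0r.
Qed.
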